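(* Let $\mathcal{S}(n)$ denote the set of sparse paving matroids with ground set $[n]=\{1,\dots,n\}$. Then $$\lim_{n\to\infty}\frac{|\{M\in\mathcal{S}(n):\operatorname{Aut}(M)=\{\mathrm{id}\}\}|}{|\mathcal{S}(n)|}=1,$$ i.e. asymptotically almost all sparse paving matroids are asymmetric.
   Context: A matroid of rank $r$ is sparse paving if every $r$-subset of the ground set that is not a basis is a circuit-hyperplane (equivalently, any two distinct $r$-element non-bases $X,Y$ satisfy $|X\triangle Y|>2$). An automorphism of a matroid $M$ on ground set $E$ is a permutation $\pi$ of $E$ such that $X$ is a basis if and only if $\pi(X)$ is a basis, for all $X\subseteq E$; $\operatorname{Aut}(M)$ is the group of automorphisms. *)

(* Defs.v *)
From HB Require Import structures.
From mathcomp Require Import all_boot all_fingroup.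

Set Implicit Arguments.
Unset Strict Implicit.
Unset Printing Implicit Defensive.

Local Open Scope group_scope.

(* A matroid is given by its family of bases: nonempty, with basis exchange. *)
Definition matroid_axiom (E : finType) (B : {set {set E}}) : bool :=
  (B != set0) &&
  [forall X in B, forall Y in B, forall x in X :\: Y,
     exists y in Y :\: X, y |: (X :\ x) \in B].

Record matroid (E : finType) := Matroid {
  bases : {set {set E}};
  matroidP : matroid_axiom bases
}.

HB.instance Definition _ (E : finType) := [isSub for @bases E].
HB.instance Definition _ (E : finType) := [Finite of matroid E by <:].

Section MatroidNotions.

Variables (E : finType) (M : matroid E).

Definition indep (X : {set E}) : bool := [exists B in bases M, X \subset B].

Definition rk (X : {set E}) : nat := \max_(B in bases M) #|B :&: X|.

Definition matroid_rank : nat := rk [set: E].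

Definition circuit (C : {set E}) : bool := minset (fun X => ~~ indep X) C.

Definition flat (F : {set E}) : bool :=
  [forall x in ~: F, (rk F < rk (x |: F))%N].

Definition hyperplane (H : {set E}) : bool :=
  flat H && ((rk H).+1 == matroid_rank).

Definition sparse_paving : bool :=
  [forall X : {set E}, (#|X| == matroid_rank) && (X \notin bases M) ==>
     circuit X && hyperplane X].

Definition matroid_aut : {set {perm E}} :=
  [set p : {perm E} |
     [forall X : {set E}, (X \in bases M) == (p @: X \in bases M)]].

Lemma matroid_aut_group_set : group_set matroid_aut.
Proof.
apply/group_setP; split=> [|p q].
  rewrite inE; apply/forallP=> X.
  by rewrite (eq_imset (g := id)) ?imset_id // => x; rewrite perm1.
rewrite !inE => /forallP Hp /forallP Hq; apply/forallP=> X.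
rewrite (eqP (Hp X)) (eqP (Hq _)) -imset_comp.
by rewrite (eq_imset (g := p * q)) // => x; rewrite /= permM.
Qed.

Canonical matroid_aut_group := Group matroid_aut_group_set.

End MatroidNotions.

(* The ground set [n] is modelled by 'I_n = {0, ..., n-1}. *)
Definition sparse_paving_matroids (n : nat) : {set matroid 'I_n} :=
  [set M : matroid 'I_n | sparse_paving M].

(* Main.v *)
(**
A sparse paving matroid of rank r on [n] is determined by its non-bases, which
form a stable set S of the Johnson graph J(n, r), and every stable set other than
the full layer arises.  Let p <> 1 be an automorphism, a an element moved by p,
b = p a, and call an r-set crossing when it contains a but not b.

If S is p-invariant with at least K crossing members, then the 2^K families
obtained by deleting crossing members are stable and determine S, because p maps
crossing sets to non-crossing ones.

Stable sets with j < K crossing members, invariant or not, are also rare: adding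
to S a crossing r-set Z that is not adjacent to crossing members of S, and deleting
the neighbours of Z, gives a stable set with j + 1 crossing members.  There are
about C(n-2, r-1) choices for Z, while the result comes from at most (j + 1) n^2
pairs (S, Z).

With K = n^3 both gains beat the n! choices of p.  The ranks r for which C(n, r) is
polynomially small contribute a negligible number of stable sets, since some
Johnson graph has a stable set of size at least 2^n / (n (n + 1)).
*)

Require Import Defs.
From mathcomp Require Import all_boot all_order all_algebra all_fingroup.
From mathcomp Require Import zify.

Set Implicit Arguments.
Unset Strict Implicit.
Unset Printing Implicit Defensive.

(** * Elementary growth estimates and a counting identity *)

Lemma expn_le_exp2 (d : nat) : exists N : nat, forall n : nat, N <= n -> n ^ d <= 2 ^ n.
Proof.
case: d => [|d]; first by exists 0 => n _; rewrite expn0 expn_gt0.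
(* With [q] about [n / (2 * e)], [n <= 2 * e * 2 ^ q] gives [n ^ e <= (2 * e) ^ e * 2 ^ (q * e)].
   Here [q * e] is at most half of [n], and the threshold makes [(2 * e) ^ e] at most the other
   half. *)
set e := d.+1; exists (2 * (2 * e) ^ e) => n hn.
pose q := n %/ (2 * e).
have hq : 2 * e * q <= n by rewrite mulnC leq_divM.
have nq : n <= 2 * e * 2 ^ q.
  apply: (@leq_trans (2 * e * q.+1)); last by rewrite leq_mul2l ltn_expl // orbT.
  by rewrite mulnC ltnW // ltn_ceil // muln_gt0.
apply: (@leq_trans ((2 * e * 2 ^ q) ^ e)); first by rewrite leq_exp2r.
rewrite expnMn -expnM.
apply: (@leq_trans (2 ^ ((2 * e) ^ e) * 2 ^ (q * e))).
  by rewrite leq_mul2r ltnW ?orbT // ltn_expl.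
rewrite -expnD leq_exp2l //; move: hn hq; move: ((2 * e) ^ e) => w.
nia.
Qed.

Lemma fact_le_exp2 (n : nat) : n`! <= 2 ^ (n * n).
Proof.
elim: n => // n IHn; rewrite factS.
apply: (@leq_trans (2 ^ n.+1 * 2 ^ (n * n))).
  by rewrite leq_mul // ltnW // ltn_expl.
by rewrite -expnD leq_exp2l //; nia.
Qed.

Lemma card_dep_pairs (T U : finType) (A : {set T}) (B : T -> {set U}) :
  #|[set p : T * U | (p.1 \in A) && (p.2 \in B p.1)]| = \sum_(x in A) #|B x|.
Proof.
rewrite -sum1_card.
under [RHS]eq_bigr do rewrite -sum1_card.
rewrite pair_big_dep /=.
by apply: eq_bigl => p; rewrite inE.
Qed.

(** * Stable sets of Johnson graphs *)

Section StableFamilies.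

Variable E : finType.
Implicit Types (r : nat) (x y z u v : E) (W X Y Z : {set E}) (S T : {set {set E}}).

Definition layer r : {set {set E}} := [set X : {set E} | #|X| == r].

(* Stable sets of the Johnson graph: two r-sets have a symmetric difference of
   size 2 exactly when X :\: Y is a singleton. *)
Definition stable r : {set {set {set E}}} :=
  [set S : {set {set E}} | (S \subset layer r)
           && [forall X in S, forall Y in S, #|X :\: Y| != 1]].

Lemma stableP r S :
  reflect ({in S, forall X, #|X| = r} /\ {in S &, forall X Y, #|X :\: Y| != 1})
          (S \in stable r).
Proof.
rewrite inE; apply: (iffP andP) => [[/subsetP h1 h2]|[h1 h2]]; split.
- by move=> X /h1; rewrite inE => /eqP.
- move=> X Y XS YS; exact: (forall_inP (forall_inP h2 X XS) Y YS).
- by apply/subsetP => X XS; rewrite inE h1.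
- apply/forall_inP => X XS; apply/forall_inP => Y YS; exact: h2.
Qed.

Lemma stable_sub r S T : S \in stable r -> T \subset S -> T \in stable r.
Proof.
move=> /stableP[h1 h2] /subsetP TS; apply/stableP; split=> [X /TS|X Y /TS XS /TS YS].
  exact: h1.
exact: h2.
Qed.

Lemma exp2_le_card_stable r S : S \in stable r -> 2 ^ #|S| <= #|stable r|.
Proof.
move=> Sst; rewrite -card_powerset; apply/subset_leq_card/subsetP => T.
by rewrite inE; exact: stable_sub.
Qed.

Lemma card_stable_le r : #|stable r| <= 2 ^ #|layer r|.
Proof.
rewrite -card_powerset; apply/subset_leq_card/subsetP => S.
by rewrite !inE => /andP[].
Qed.

Lemma cardsD_sym X Y : #|X| = #|Y| -> #|X :\: Y| = #|Y :\: X|.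
Proof. by move=> XY; rewrite !cardsD setIC XY. Qed.

Lemma card_swap X x y : x \in X -> y \notin X -> #|y |: (X :\ x)| = #|X|.
Proof.
move=> xX yX; rewrite cardsU1 !inE (negPf yX) andbF (cardsD1 x X) xX.
by [].
Qed.

Lemma swapD X x y : x \in X -> y \notin X -> X :\: (y |: (X :\ x)) = [set x].
Proof.
move=> xX yX; apply/setP => z; rewrite !inE.
have [->|_] := eqVneq z x; last by case: (z \in X); rewrite ?andbF ?orbT.
by rewrite xX /= andbT orbF; apply: contraNneq yX => <-.
Qed.

Lemma swapP X Y : #|X| = #|Y| -> #|X :\: Y| = 1 ->
  exists x y, [/\ x \in X, y \notin X & Y = y |: (X :\ x)].
Proof.
move=> cXY c1; have /eqP/cards1P[x xE] := c1.
have /eqP/cards1P[y yE] : #|Y :\: X| = 1 by rewrite -cardsD_sym.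
have : x \in X :\: Y by rewrite xE inE.
have : y \in Y :\: X by rewrite yE inE.
rewrite !inE => /andP[yX yY] /andP[xY xX]; exists x, y; split=> //.
apply/setP => z; move/setP/(_ z): xE; move/setP/(_ z): yE; rewrite !inE.
by case: (z \in X); case: (z \in Y) => /= <- <-.
Qed.

Definition crossing (a b : E) : {set {set E}} :=
  [set X : {set E} | (a \in X) && (b \notin X)].

Definition invariant (p : {perm E}) S : bool :=
  [forall X : {set E}, (X \in S) == (p @: X \in S)].

(* A set X in [crossing a (p a)] is moved by p outside it; hence an
   invariant family is determined by what is left after removing from it any
   of its crossing members. *)
Lemma card_invariant_crossing r K (p : {perm E}) (a : E) :
  2 ^ K * #|[set S in stable r | invariant p S
                               && (K <= #|S :&: crossing a (p a)|)]|
    <= #|stable r|.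
Proof.
set A := [set S in _ | _].
(* If [T] is [S] with a set [D] of crossing members deleted, then [cl T] is [S]: the image of a
   deleted set contains [p a], so it is not crossing and survives in [T]. Hence [g] reaches every
   pair [(S, D)]. *)
pose cl T := T :|: [set X : {set E} | p @: X \in T].
pose g T := (cl T, cl T :\: T).
have := leq_imset_card g (stable r); apply: leq_trans.
apply: (@leq_trans #|[set q : {set {set E}} * {set {set E}} |
          (q.1 \in A) && (q.2 \in powerset (q.1 :&: crossing a (p a)))]|); last first.
  apply/subset_leq_card/subsetP => -[S D]; rewrite !inE /=.
  rewrite -andbA => /andP[/andP[Slay Sst]] /andP[/andP[/forallP Sinv _]].
  rewrite subsetI => /andP[DS /subsetP Dcr].
  apply/imsetP; exists (S :\: D).
    apply: stable_sub (subsetDl _ _); by rewrite inE Slay.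
  suff SE : S :\: D :|: [set X : {set E} | p @: X \in S :\: D] = S.
    by rewrite /g /cl SE; congr pair; rewrite setDDr setDv set0U; apply/esym/setIidPr.
  apply/setP => X; rewrite !inE.
  have [XD|XD] /= := boolP (X \in D).
    have := Dcr _ XD; rewrite inE => /andP[aX _].
    rewrite (subsetP DS _ XD) -(eqP (Sinv X)) (subsetP DS _ XD) andbT.
    by apply: contraL (imset_f p aX) => /Dcr; rewrite !inE => /andP[].
  by rewrite -(eqP (Sinv X)); case: (X \in S); rewrite ?andbF.
rewrite (card_dep_pairs A (fun S => powerset (S :&: crossing a (p a)))) mulnC.
rewrite -sum_nat_const; apply: leq_sum => S.
by rewrite !inE card_powerset leq_exp2l // => /andP[_ /andP[_]].
Qed.

(** * Stable sets graded by their number of crossing members *)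

Section Levels.

Variables (a b : E) (r : nat).

Let C := layer r :&: crossing a b.
Let sqE := #|E| * #|E|.

Definition level j : {set {set {set E}}} :=
  [set S in stable r | #|S :&: crossing a b| == j].

(** For nonempty [X] this contains the closed Johnson neighbourhood of [X]. Degenerate pairs may add
    further sets, which is harmless since only an upper bound on the size matters. *)
Definition swap_ball X : {set {set E}} := [set q.2 |: (X :\ q.1) | q : E * E].

Lemma card_swap_ball X : #|swap_ball X| <= sqE.
Proof.
by rewrite /sqE -card_prod leq_imset_card.
Qed.

Definition avail S : {set {set E}} :=
  C :\: \bigcup_(X in S :&: crossing a b) swap_ball X.

Lemma card_avail j S : S \in level j -> #|C| - j * sqE <= #|avail S|.
Proof.
rewrite inE => /andP[_ /eqP Sj]; rewrite leq_subLR.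
rewrite -(cardsID (\bigcup_(X in S :&: crossing a b) swap_ball X) C).
rewrite leq_add2r; apply: leq_trans (subset_leq_card (subsetIr _ _)) _.
rewrite -Sj -sum_nat_const.
elim/big_rec2: _ => [|X m U _ IH]; first by rewrite cards0.
by rewrite (leq_trans (leq_card_setU _ _)) // leq_add // card_swap_ball.
Qed.

Lemma cardU1D W u v : u \notin W -> u != v -> #|(u |: W) :\: (v |: W)| = 1.
Proof.
move=> uW uv; rewrite -(cards1 u); congr #|pred_of_set _|; apply/setP => x.
rewrite !inE; have [->|xu] := eqVneq x u; first by rewrite (negPf uv) (negPf uW).
by case: (x \in W); rewrite ?orbT ?andbF.
Qed.

Lemma cardD1D W u v : v \in W -> u != v -> #|(W :\ u) :\: (W :\ v)| = 1.
Proof.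
move=> vW uv; rewrite -(cards1 v); congr #|pred_of_set _|; apply/setP => x.
rewrite !inE; have [->|xv] := eqVneq x v; first by rewrite eq_sym uv vW.
by case: (x \in W); rewrite ?andbF.
Qed.

(* The neighbours of Z outside [crossing a b] form two cliques, obtained by
   replacing a, respectively by inserting b; so S meets each in at most one
   set, and S is recovered from T, Z and a pair of elements of E. *)
Lemma level_step_preimage j S Z : S \in level j -> Z \in avail S ->
  exists T y z, [/\ T \in level j.+1, Z \in T :&: crossing a b &
    (T :|: [set y |: (Z :\ a); (b |: Z) :\ z]) :\ Z = S].
Proof.
rewrite inE => /andP[/stableP[Sr Sst] /eqP Sj].
rewrite in_setD in_setI !inE => /andP[Zball /andP[/eqP Zr Zab]].
have [aZ bZ] := andP Zab.
have nball X : X \in S -> X \in crossing a b -> Z \notin swap_ball X.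
  move=> XS Xab; apply: contra Zball => ZX; apply/bigcupP; exists X => //.
  by rewrite inE XS.
have ZS : Z \notin S.
  apply/negP => ZS; have Zab' : Z \in crossing a b by rewrite inE.
  have /negP[] := nball Z ZS Zab'.
  by apply/imsetP; exists (a, a); rewrite //= setD1K.
pose N := [set Y : {set E} | #|Z :\: Y| == 1].
have Nab X : X \in S -> X \in N -> X \notin crossing a b.
  rewrite inE => XS /eqP cX; apply/negP => Xab; have /negP[] := nball X XS Xab.
  have cXZ : #|X| = #|Z| by rewrite Sr.
  have [x [y [_ _ ZE]]] := swapP cXZ (etrans (cardsD_sym cXZ) cX).
  by apply/imsetP; exists (x, y).
(* By [Nab] the deleted neighbours are all non-crossing, so the crossing count rises by exactly
   one. *)
pose T := Z |: (S :\: N).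
pose py := [pred y | (y \notin Z) && (y |: (Z :\ a) \in S)].
pose pz := [pred z | (z \in Z) && ((b |: Z) :\ z \in S)].
(* With the defaults [a] and [b], used when a clique misses [S], the recovered set is [Z] itself,
   which the final [:\ Z] discards. *)
pose y := odflt a (pick py); pose z := odflt b (pick pz).
have yP X v : X \in S -> v \notin Z -> X = v |: (Z :\ a) -> X = y |: (Z :\ a).
  move=> XS vZ XE; rewrite /y; case: pickP => [w /andP[wZ wS]|/(_ v)] /=; last first.
    by rewrite vZ -XE XS.
  have [<- //|vw] := eqVneq v w.
  have /eqP[] := Sst _ _ XS wS; rewrite XE cardU1D //.
  by rewrite !inE (negPf vZ) andbF.
have zP X v : X \in S -> v \in Z -> X = (b |: Z) :\ v -> X = (b |: Z) :\ z.
  move=> XS vZ XE; rewrite /z; case: pickP => [w /andP[wZ wS]|/(_ v)] /=; last first.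
    by rewrite vZ -XE XS.
  have [<- //|vw] := eqVneq v w.
  have /eqP[] := Sst _ _ XS wS; rewrite XE cardD1D //.
  by rewrite !inE wZ orbT.
have y1 : y |: (Z :\ a) \in Z |: S.
  rewrite /y; case: pickP => [w /andP[_ wS]|_] /=; first by rewrite !inE wS orbT.
  by rewrite setD1K // !inE eqxx.
have z1 : (b |: Z) :\ z \in Z |: S.
  rewrite /z; case: pickP => [w /andP[_ wS]|_] /=; first by rewrite !inE wS orbT.
  by rewrite setU1K // !inE eqxx.
exists T, y, z; split.
- have TE : T :&: crossing a b = Z |: (S :&: crossing a b).
    apply/setP => X; rewrite in_setI !in_setU1 in_setD in_setI.
    have [->|_] /= := eqVneq X Z; first by rewrite inE Zab.
    have [XS|] := boolP (X \in S); last by rewrite andbF.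
    have [XN|_] //= := boolP (X \in N).
    by rewrite (negPf (Nab X XS XN)).
  have cT : #|T :&: crossing a b| = j.+1.
    by rewrite TE cardsU1 in_setI (negPf ZS) /= Sj.
  rewrite in_set cT eqxx andbT.
  have NZ X : X \in S -> X \notin N -> #|X :\: Z| != 1 /\ #|Z :\: X| != 1.
    move=> XS; rewrite inE => XN; split=> //.
    by rewrite cardsD_sym // Sr.
  apply/stableP; split=> [X|X Y].
    by rewrite !inE => /orP[/eqP->//|/andP[_ /Sr]].
  rewrite !in_setU1 !in_setD => /orP[/eqP->|/andP[XN XS]] /orP[/eqP->|/andP[YN YS]].
  + by rewrite setDv cards0.
  + by have [] := NZ Y YS YN.
  + by have [] := NZ X XS XN.
  + exact: Sst.
- by rewrite !inE eqxx Zab.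
apply/setP => X; rewrite in_setD1.
have [->|XZ] /= := eqVneq X Z; first by rewrite (negPf ZS).
rewrite in_setU /T in_setU1 (negPf XZ) in_setD in_set2 /=.
have [XS|XS] /= := boolP (X \in S); last first.
  rewrite andbF /=; apply/negP => /orP[] /eqP XE.
    by move: y1; rewrite -XE in_setU1 (negPf XZ) (negPf XS).
  by move: z1; rewrite -XE in_setU1 (negPf XZ) (negPf XS).
rewrite andbT; have [XN|//] /= := boolP (X \in N).
have Xab := Nab X XS XN.
have cX : #|Z :\: X| = 1 by apply/eqP; rewrite inE in XN.
have [u [v [uZ vZ XE]]] := swapP (etrans Zr (esym (Sr _ XS))) cX.
(* The deleted neighbour [X] is [Z] with [u] replaced by [v]. If [u] is not [a], then [X] still
   contains [a]; being non-crossing it must contain [b], so [v] is [b]. *)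
have [ua|ua] := eqVneq u a.
  by rewrite -(yP X v) ?eqxx // XE ua.
have vb : v = b.
  move: Xab; rewrite XE !inE aZ (eq_sym a u) ua orbT /= (negPf bZ) andbF orbF negbK.
  by move/eqP->.
have XE' : X = (b |: Z) :\ u.
  rewrite XE vb; apply/setP => x; rewrite !inE.
  have [->|] := eqVneq x b; rewrite ?andbT //=.
  by apply/esym; apply: contraNneq bZ => ->.
by rewrite -(zP X u) ?eqxx ?orbT.
Qed.

(** Double counting of the pairs [(S, Z)] with [Z] available for [S]. By [level_step_preimage] each
    is decoded by [h] from a set [T] of the next level, one of its [j.+1] crossing members and a
    pair of elements. *)
Lemma level_step j :
  #|level j| * (#|C| - j * sqE) <= #|level j.+1| * j.+1 * sqE.
Proof.
pose A := [set q : {set {set E}} * {set E} | (q.1 \in level j) && (q.2 \in avail q.1)].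
pose B := [set q : {set {set E}} * {set E} |
             (q.1 \in level j.+1) && (q.2 \in q.1 :&: crossing a b)].
pose h (q : ({set {set E}} * {set E}) * (E * E)) : {set {set E}} * {set E} :=
  ((q.1.1 :|: [set q.2.1 |: (q.1.2 :\ a); (b |: q.1.2) :\ q.2.2]) :\ q.1.2, q.1.2).
apply: (@leq_trans #|A|).
  rewrite (card_dep_pairs (level j) avail) -sum_nat_const.
  by apply: leq_sum => S /card_avail.
apply: (@leq_trans #|setX B [set: E * E]|); last first.
  rewrite cardsX cardsT card_prod leq_mul2r.
  rewrite (card_dep_pairs _ (fun S => S :&: crossing a b)) -sum_nat_const.
  by apply/orP; right; apply: leq_sum => S; rewrite inE => /andP[_ /eqP->].
apply: leq_trans (leq_imset_card h _); apply/subset_leq_card/subsetP => -[S Z].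
rewrite inE /= => /andP[Sj Zav].
have [T [y [z [Tj ZT TE]]]] := level_step_preimage Sj Zav.
apply/imsetP; exists ((T, Z), (y, z)); last by rewrite /h /= TE.
by rewrite in_setX in_setT andbT inE Tj.
Qed.

(** The lower bound on [#|C|] makes [#|C| - i * sqE] at least [2 * i.+1 * sqE] for [i < 2 * K], so
    by [level_step] each such level at least doubles in size. Starting from [j <= K] there is room
    for [K] doublings. *)
Lemma card_level K j : 0 < #|E| -> j <= K -> 6 * K * sqE <= #|C| ->
  2 ^ K * #|level j| <= #|stable r|.
Proof.
move=> E0 jK CK.
have step i : i < 2 * K -> 2 * #|level i| <= #|level i.+1|.
  move=> iK; have := level_step i.
  have sq0 : 0 < sqE by rewrite muln_gt0 E0.
  have : 2 * i.+1 * sqE <= #|C| - i * sqE.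
    rewrite leq_subRL; last by apply: leq_trans CK; nia.
    by apply: leq_trans CK; rewrite -mulnDl leq_mul2r; apply/orP; right; lia.
  move=> h1 h2; have : #|level i| * (2 * i.+1 * sqE) <= #|level i.+1| * i.+1 * sqE.
    by apply: leq_trans h2; rewrite leq_mul2l h1 orbT.
  rewrite (_ : _ * _ = (2 * #|level i|) * (i.+1 * sqE)); last by lia.
  by rewrite -[X in _ <= X]mulnA leq_pmul2r // muln_gt0.
have iter k : k <= K -> 2 ^ k * #|level j| <= #|level (j + k)|.
  elim: k => [|k IHk] kK; first by rewrite expn0 mul1n addn0.
  rewrite expnS -mulnA addnS; apply: leq_trans (step _ _); last lia.
  by rewrite leq_mul2l IHk // ltnW.
apply: leq_trans (iter K _) _ => //.
by apply/subset_leq_card/subsetP => S; rewrite inE => /andP[].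
Qed.

End Levels.

(** * Rarity of stable sets with a nontrivial symmetry *)

Lemma card_layer_crossing r a b : a != b -> 1 < #|layer r| ->
  #|layer r| <= #|layer r :&: crossing a b| * (#|E| * #|E|).
Proof.
move=> ab lay1; have cl : #|layer r| = 'C(#|E|, r) by exact: card_draws.
(* Two transpositions, one moving [a] and one moving [b], carry some crossing set onto any given
   [X]; only their second points have to be recorded. *)
pose h (q : {set E} * (E * E)) : {set E} :=
  tperm a q.2.1 @: (tperm b q.2.2 @: q.1).
rewrite -card_prod -cardsT -cardsX.
apply: leq_trans (leq_imset_card h _); apply/subset_leq_card/subsetP => X.
rewrite inE => /eqP Xr.
(* A layer with more than one set is neither the bottom nor the top one, so [X] has an element and
   misses an element. *)
have [x xX] : exists x, x \in X.
  apply/set0Pn; apply: contraTneq lay1 => X0.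
  by rewrite cl -Xr X0 cards0 bin0.
have [y yX] : exists y, y \notin X.
  have : ~: X != set0.
    apply: contraTneq lay1 => X0.
    by rewrite cl -Xr -(cardsC X) X0 cards0 addn0 binn.
  by case/set0Pn => y; rewrite inE; exists y.
pose t := tperm a x; pose X1 := t @: X; pose y1 := t y.
have aX1 : a \in X1 by apply/imsetP; exists x; rewrite // tpermR.
have y1X1 : y1 \notin X1 by rewrite (mem_imset _ _ (@perm_inj _ t)).
have ay1 : a != y1 by apply: contraNneq y1X1 => <-.
have tK (u v : E) (Y : {set E}) : tperm u v @: (tperm u v @: Y) = Y.
  rewrite -imset_comp -[RHS]imset_id; apply: eq_imset => z /=; exact: tpermK.
apply/imsetP; exists (tperm b y1 @: X1, (x, y1)); last by rewrite /h /= !tK.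
rewrite !inE /= !card_imset ?Xr ?eqxx; try exact: perm_inj.
rewrite !andbT /=; apply/andP; split.
  by apply/imsetP; exists a; rewrite // tpermD // eq_sym.
by rewrite -[X in X \notin _](tpermR b y1) (mem_imset _ _ (@perm_inj _ _)).
Qed.

(** Choose [a] moved by [p]. Invariant sets with at least [K] crossing members are handled by
    [card_invariant_crossing], the [K] lower levels by [card_level], which yields the factor [K.+1].
    Of the exponent 4, one square pays for passing from the layer to its crossing sets, the other
    for [sqE]. *)
Lemma card_invariant r K (p : {perm E}) : p != 1%g ->
    6 * K * #|E| ^ 4 <= #|layer r| -> 1 < #|layer r| ->
  2 ^ K * #|[set S in stable r | invariant p S]| <= K.+1 * #|stable r|.
Proof.
move=> p1 big big1.
have [a pa] : exists a, a != p a.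
  apply/existsP; apply: contraNT p1 => /existsPn np.
  by apply/eqP/permP => x; rewrite perm1; apply/esym/eqP; rewrite -[_ == _]negbK np.
have E0 : 0 < #|E| by apply/card_gt0P; exists a.
have bigC : 6 * K * (#|E| * #|E|) <= #|layer r :&: crossing a (p a)|.
  rewrite -(@leq_pmul2r (#|E| * #|E|)) ?muln_gt0 ?E0 //.
  apply: leq_trans (card_layer_crossing pa big1).
  by apply: leq_trans big; rewrite -mulnA leq_mul2l -!mulnA; apply/orP; right.
have sub : [set S in stable r | invariant p S] \subset
    [set S in stable r | invariant p S && (K <= #|S :&: crossing a (p a)|)]
    :|: \bigcup_(j < K) level a (p a) r j.
  apply/subsetP => S /setIdP[Sst pS]; apply/setUP.
  have [jK|jK] := leqP K #|S :&: crossing a (p a)|; [left|right].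
    by apply/setIdP; rewrite pS.
  by apply/bigcupP; exists (Ordinal jK) => //; apply/setIdP.
apply: leq_trans (leq_mul (leqnn _) (subset_leq_card sub)) _.
apply: leq_trans (leq_mul (leqnn _) (leq_card_setU _ _)) _.
rewrite mulnDr mulSn leq_add //; first exact: card_invariant_crossing.
have : #|\bigcup_(j < K) level a (p a) r j| <= \sum_(j < K) #|level a (p a) r j|.
  elim/big_rec2: _ => [|j m U _ IH]; first by rewrite cards0.
  by rewrite (leq_trans (leq_card_setU _ _)) // leq_add.
move=> /(leq_mul (leqnn (2 ^ K)))/leq_trans; apply.
rewrite big_distrr /= -[K in K * _]card_ord -sum_nat_const.
by apply: leq_sum => j _; apply: card_level => //; exact: ltnW.
Qed.

Definition symmetric_stable r : {set {set {set E}}} :=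
  [set S in stable r | [exists p : {perm E}, (p != 1%g) && invariant p S]].

(** On a large layer, a union bound over permutations gives the first term. On a small layer, the
    second term already bounds the number of all stable sets. *)
Lemma card_symmetric_stable r K : 0 < K -> 0 < #|E| ->
  2 ^ K * #|symmetric_stable r|
    <= #|E|`! * K.+1 * #|stable r| + 2 ^ K * 2 ^ (6 * K * #|E| ^ 4).
Proof.
move=> K0 E0; have [big|small] := leqP (6 * K * #|E| ^ 4) #|layer r|; last first.
  apply: leq_trans (leq_addl _ _); rewrite leq_mul2l; apply/orP; right.
  apply: (@leq_trans #|stable r|).
    by apply/subset_leq_card/subsetP => S; rewrite inE => /andP[].
  by apply: leq_trans (card_stable_le r) _; rewrite leq_exp2l // ltnW.
apply: leq_trans (leq_addr _ _).
have sub : symmetric_stable r \subset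
    \bigcup_(p : {perm E} | p != 1%g) [set S in stable r | invariant p S].
  apply/subsetP => S; rewrite inE => /andP[Sst /existsP[p /andP[p1 pS]]].
  by apply/bigcupP; exists p; rewrite // inE Sst.
have cperm : #|{: {perm E}}| = #|E|`!.
  rewrite -[#|E|]cardsT -card_perm -cardsT; apply: eq_card => p.
  rewrite inE; apply/esym/subsetP => x; by rewrite inE.
rewrite -cperm -mulnA -sum_nat_const.
apply: (@leq_trans (2 ^ K * \sum_(p : {perm E} | p != 1%g)
                              #|[set S in stable r | invariant p S]|)).
  rewrite leq_mul2l; apply/orP; right; apply: leq_trans (subset_leq_card sub) _.
  elim/big_rec2: _ => [|j m U _ IH]; first by rewrite cards0.
  by rewrite (leq_trans (leq_card_setU _ _)) // leq_add.
rewrite big_distrr /= [X in _ <= X](bigID (fun p : {perm E} => p != 1%g)) /=.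
apply: leq_trans (leq_addr _ _); apply: leq_sum => p p1.
apply: card_invariant => //; apply: leq_trans big.
have : 0 < #|E| ^ 4 by rewrite expn_gt0 E0.
by move: (#|E| ^ 4) => w; nia.
Qed.

End StableFamilies.

(* Graham-Sloane: moving one element of a set changes the sum of its elements
   modulo n, so each colour class of (cardinality, sum mod n) is stable. *)
Lemma large_stable (n : nat) : 0 < n ->
  exists (r : 'I_n.+1) (S : {set {set 'I_n}}),
    S \in stable 'I_n r /\ 2 ^ n <= #|S| * (n * n.+1).
Proof.
case: n => // n _.
pose colour (X : {set 'I_n.+1}) : 'I_n.+1 * 'I_n.+2 :=
  (inord ((\sum_(x in X) x) %% n.+1), inord #|X|).
pose fiber c := [set X | colour X == c].
have total : \sum_c #|fiber c| = 2 ^ n.+1.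
  rewrite -[n.+1 in RHS]card_ord -[in RHS]cardsT -card_powerset powersetT cardsT.
  rewrite -sum1_card (partition_big colour xpredT) //=.
  apply: eq_bigr => c _; rewrite -sum1_card; apply: eq_bigl => X.
  by rewrite inE.
have c0 : 0 < #|{: 'I_n.+1 * 'I_n.+2}| by rewrite card_prod !card_ord.
(* Pigeonhole: a largest colour class has at least the average size. *)
have [c cE] := eq_bigmax (fun c => #|fiber c|) c0.
exists c.2, (fiber c); split; last first.
  have cc : n.+1 * n.+2 = #|{: 'I_n.+1 * 'I_n.+2}| by rewrite card_prod !card_ord.
  rewrite -cE -total mulnC cc -sum_nat_const; apply: leq_sum => d _.
  exact: (leq_bigmax (F := fun c => #|fiber c|)).
have cardP X : X \in fiber c -> #|X| = c.2.
  rewrite inE => /eqP <- /=; rewrite inordK // ltnS.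
  by apply: leq_trans (max_card _) _; rewrite card_ord.
apply/stableP; split=> // X Y Xc Yc; apply/eqP => cXY.
have [x [y [xX yX YE]]] := swapP (etrans (cardP X Xc) (esym (cardP Y Yc))) cXY.
have sumX : \sum_(z in X) z = x + \sum_(z in X :\ x) z by rewrite (big_setD1 x).
have sumY : \sum_(z in Y) z = y + \sum_(z in X :\ x) z.
  by rewrite YE big_setU1 // !inE (negPf yX) andbF.
have : x + \sum_(z in X :\ x) z = y + \sum_(z in X :\ x) z %[mod n.+1].
  rewrite -sumX -sumY.
  move: Xc Yc; rewrite !inE => /eqP Xc /eqP; rewrite -{}Xc => -[/(congr1 val) /=].
  by rewrite !inordK ?ltn_pmod // => ->.
move/eqP; rewrite eqn_modDr !modn_small // => /eqP/val_inj xy.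
by rewrite -xy xX in yX.
Qed.

(** * Correspondence between sparse paving matroids and stable sets *)

Section SparsePaving.

Variable E : finType.
Implicit Types (M : matroid E) (r : nat) (B X Y : {set E}) (S : {set {set E}}).

Lemma basis_exchange M X Y x : X \in bases M -> Y \in bases M ->
  x \in X :\: Y -> exists2 y, y \in Y :\: X & y |: (X :\ x) \in bases M.
Proof.
move=> XM YM xXY; have /andP[_ /forall_inP/(_ X XM)/forall_inP] := matroidP M.
by move=> /(_ Y YM)/forall_inP/(_ x xXY)/exists_inP.
Qed.

Lemma ex_basis M : exists B, B \in bases M.
Proof. by have /andP[/set0Pn[B BM] _] := matroidP M; exists B. Qed.

(** Induction on [#|X :\: Y|]: an exchange towards [Y] keeps the size of [X] and shrinks this
    difference. If it is empty, so is [Y :\: X], since an exchange from [Y] towards [X] would have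
    nothing to insert. *)
Lemma card_bases M X Y : X \in bases M -> Y \in bases M -> #|X| = #|Y|.
Proof.
move=> + YM; have [k] := ubnP #|X :\: Y|; elim: k X => // k IHk X kX XM.
have [XY0|[x xXY]] := set_0Vmem (X :\: Y).
  suff YX0 : Y :\: X = set0.
    by apply/eqP; rewrite eqn_leq !subset_leq_card // -setD_eq0 ?XY0 ?YX0.
  apply/eqP; apply: contraT => /set0Pn[y yYX].
  by have [x] := basis_exchange YM XM yYX; rewrite XY0 inE.
have [y yYX X'M] := basis_exchange XM YM xXY.
move: xXY yYX; rewrite !inE => /andP[xY xX] /andP[yX yY].
rewrite -(card_swap xX yX); apply: IHk => //.
rewrite (_ : _ :\: Y = (X :\: Y) :\ x).
  by move: kX; rewrite (cardsD1 x (X :\: Y)) !inE xY xX.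
apply/setP => z; rewrite !inE; have [->|_] := eqVneq z y; first by rewrite yY andbF.
by rewrite /= andbCA.
Qed.

Lemma rank_basis M B : B \in bases M -> matroid_rank M = #|B|.
Proof.
move=> BM; apply/eqP; rewrite eqn_leq; apply/andP; split.
  by apply/bigmax_leqP => X XM; rewrite setIT (card_bases XM BM).
rewrite -{1}[B]setIT.
exact: (leq_bigmax_cond (F := fun X : {set E} => #|X :&: [set: E]|) _ BM).
Qed.

Definition nonbases M : {set {set E}} := layer E (matroid_rank M) :\: bases M.

Lemma bases_layer M : bases M \subset layer E (matroid_rank M).
Proof. by apply/subsetP => B BM; rewrite inE (rank_basis BM). Qed.

Lemma nonbases_inj M N :
  matroid_rank M = matroid_rank N -> nonbases M = nonbases N -> M = N.
Proof.
move=> rMN nMN; apply: val_inj => /=.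
have basesE M' : bases M' = layer E (matroid_rank M') :\: nonbases M'.
  by rewrite setDDr setDv set0U; apply/esym/setIidPr/bases_layer.
by rewrite basesE nMN rMN -basesE.
Qed.

(** Suppose [X] and [Y = y |: (X :\ x)] are both non-bases. Since [X] is a circuit, some basis [B]
    contains [X :\ x]; since [X] is a hyperplane, some basis [B'] lies in [y |: X]. Exchanging an
    element of [B] outside [X] towards [B'] inserts [x] or [y], and the new basis is then [X] or
    [Y], a contradiction. *)
Lemma nonbases_stable M : sparse_paving M -> nonbases M \in stable E (matroid_rank M).
Proof.
move=> /forallP sp; apply/stableP; split=> [X|X Y].
  by rewrite !inE => /andP[_ /eqP].
rewrite !inE => /andP[XM /eqP Xr] /andP[YM /eqP Yr]; apply/eqP => cXY.
have [x [y [xX yX YE]]] := swapP (etrans Xr (esym Yr)) cXY.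
have := sp X; rewrite Xr eqxx XM /= => /andP[/minsetP[_ Xmin] /andP[flatX /eqP rkX]].
have [B BM XB] : exists2 B, B \in bases M & X :\ x \subset B.
  apply/exists_inP; apply: contraT => Xdep.
  have /setP/(_ x) := Xmin _ Xdep (subsetDl _ _); by rewrite !inE eqxx xX.
have [B' B'M B'X] : exists2 B', B' \in bases M & B' \subset y |: X.
  have rkXy : matroid_rank M <= rk M (y |: X).
    by rewrite -rkX; apply: (forall_inP flatX); rewrite inE.
  have M0 : 0 < #|bases M| by have [B0 B0M] := ex_basis M; apply/card_gt0P; exists B0.
  have [B' B'M rkE] := eq_bigmax_cond (fun B => #|B :&: (y |: X)|) M0.
  exists B' => //; apply/setIidPl/eqP; rewrite eqEcard subsetIl -rkE.
  by rewrite -(rank_basis B'M).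
have sub_basis (Z B0 : {set E}) :
    B0 \in bases M -> #|Z| = matroid_rank M -> Z \notin bases M ->
    ~~ (Z \subset B0).
  move=> B0M Zr; apply: contra => ZB0.
  suff -> : Z = B0 by [].
  by apply/eqP; rewrite eqEcard ZB0 Zr -(rank_basis B0M) leqnn.
have xB : x \notin B.
  apply: contra (sub_basis _ _ BM Xr XM) => xB.
  by rewrite -(setD1K xX) subUset sub1set xB.
have yB : y \notin B.
  apply: contra (sub_basis _ _ BM Yr YM) => yB.
  by rewrite YE subUset sub1set yB.
have [w wB wX] : exists2 w, w \in B & w \notin X.
  apply/subsetPn; apply: contra (XM) => BX.
  suff -> : X = B by [].
  by apply/esym/eqP; rewrite eqEcard BX Xr (rank_basis BM) leqnn.
have wB' : w \in B :\: B'.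
  rewrite inE wB andbT; apply: contra (wX) => /(subsetP B'X).
  by rewrite !inE => /predU1P[wy|//]; rewrite -wy wB in yB.
have [v vB'B v_basis] := basis_exchange BM B'M wB'.
have Xw : X :\ x \subset B :\ w.
  by rewrite subsetD1 XB !inE (negPf wX) andbF.
have vXx : v |: (X :\ x) \subset v |: (B :\ w) by rewrite setUS.
move: vB'B; rewrite inE => /andP[vB /(subsetP B'X)]; rewrite in_setU1.
case/predU1P=> [vy|vX].
  by have /negP[] := sub_basis _ _ v_basis Yr YM; rewrite YE -vy.
have vx : v = x.
  by apply/eqP; apply: contraNT vB => vx; apply: (subsetP XB); rewrite !inE vx.
by have /negP[] := sub_basis _ _ v_basis Xr XM; rewrite -(setD1K xX) -{1}vx.
Qed.

(** The full layer is excluded because a matroid has at least one basis. *)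
Lemma stable_nonbases r S : S \in stable E r -> S != layer E r ->
  exists M, [/\ sparse_paving M, matroid_rank M = r & nonbases M = S].
Proof.
move=> /stableP[Sr Sst] Sneq.
have SL : S \subset layer E r by apply/subsetP => X /Sr; rewrite inE => ->.
pose Bs := layer E r :\: S.
have [B0] : exists B0, B0 \in Bs.
  apply/set0Pn; apply: contraNneq Sneq => /eqP; rewrite setD_eq0 => LS.
  by rewrite eqEsubset SL.
rewrite !inE => /andP[B0S /eqP B0r].
(* Two sets X - x + y and X - x + y' are adjacent, so at most one is in S. *)
have Bsax : matroid_axiom Bs.
  apply/andP; split; first by apply/set0Pn; exists B0; rewrite !inE B0S B0r eqxx.
  apply/forall_inP => X; rewrite !inE => /andP[XS /eqP Xr].
  apply/forall_inP => Y; rewrite !inE => /andP[YS /eqP Yr].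
  apply/forall_inP => x; rewrite inE => /andP[xY xX]; apply/exists_inP.
  have [y yYX] : exists y, y \in Y :\: X.
    apply/set0Pn; rewrite -card_gt0 -cardsD_sym ?Xr ?Yr // card_gt0.
    by apply/set0Pn; exists x; rewrite inE xY.
  have := yYX; rewrite inE => /andP[yX yY].
  have inBs z : z \notin X -> (z |: (X :\ x) \in Bs) = (z |: (X :\ x) \notin S).
    by move=> zX; rewrite !inE card_swap // Xr eqxx andbT.
  (* If [Y :\: X] is a single point, the only possible exchange produces [Y] itself. Otherwise there
     are two candidates to choose from. *)
  have [y1|/eqP yn] := eqVneq (Y :\: X) [set y].
    exists y => //; rewrite inBs //; suff <- : Y = y |: (X :\ x) by [].
    have c1 : #|X :\: Y| = 1 by rewrite cardsD_sym ?Xr ?Yr // y1 cards1.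
    have [x' [y' [x'X y'X YE]]] := swapP (etrans Xr (esym Yr)) c1.
    have x'x : x' = x.
      move: xY; rewrite YE !inE xX andbT negb_or negbK => /andP[_ /eqP->//].
    have : y' \in Y :\: X by rewrite YE !inE y'X eqxx.
    by rewrite y1 inE => /eqP <-; rewrite YE x'x.
  have [z zYX zy] : exists2 z, z \in Y :\: X & z \notin [set y].
    apply/subsetPn/negP; rewrite subset1 => /orP[/eqP //|/eqP Y0].
    by rewrite Y0 inE in yYX.
  have := zYX; rewrite !inE in zy *; move=> /andP[zX zY].
  have [yS|yS] := boolP (y |: (X :\ x) \in S); last by exists y; rewrite ?inBs.
  exists z; rewrite ?inBs //.
  apply: contraTN isT => zS; have /eqP[] := Sst _ _ yS zS.
  by rewrite cardU1D // ?(eq_sym y) // !inE (negPf yX) andbF.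
pose M := Matroid Bsax.
have rM : matroid_rank M = r by rewrite (@rank_basis M B0) // !inE B0S B0r eqxx.
have nM : nonbases M = S.
  by rewrite /nonbases rM /= setDDr setDv set0U; apply/setIidPr.
exists M; split=> //; apply/forallP => X; rewrite rM.
apply/implyP => /andP[/eqP Xr XnM].
have XS : X \in S by rewrite -nM in_setD XnM inE rM Xr eqxx.
have BsE Y : (Y \in bases M) = (Y \notin S) && (#|Y| == r) by rewrite !inE.
have XsubE Y : Y \in bases M -> X \subset Y -> False.
  rewrite BsE => /andP[YS /eqP Yr] XY; case/negP: YS.
  suff <- : X = Y by [].
  by apply/eqP; rewrite eqEcard XY Xr Yr leqnn.
have [y yB0 yX] : exists2 y, y \in B0 & y \notin X.
  apply/subsetPn; apply: contra B0S => B0X; suff -> : B0 = X by [].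
  by apply/eqP; rewrite eqEcard B0X Xr B0r leqnn.
(* All neighbours of the non-basis [X] are bases. They show that [X] has rank [r.-1], that adding
   any outside point raises the rank, and that every proper subset of [X] is independent. *)
have swapM x z : x \in X -> z \notin X -> z |: (X :\ x) \in bases M.
  move=> xX zX; rewrite BsE card_swap // Xr eqxx andbT.
  apply/negP => zS; have /eqP[] := Sst _ _ XS zS.
  by rewrite swapD // cards1.
have [x xX] : exists x, x \in X.
  apply/set0Pn; rewrite -card_gt0 Xr -B0r; apply/card_gt0P; by exists y.
have rX : rk M X = r.-1.
  apply/eqP; rewrite eqn_leq; apply/andP; split.
    apply/bigmax_leqP => Y YM; rewrite -ltnS prednK; last first.
      by rewrite -Xr; apply/card_gt0P; exists x.
    rewrite -Xr; apply: proper_card; rewrite properEneq subsetIr andbT.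
    by apply/eqP => /setIidPr /(XsubE _ YM).
  have := leq_bigmax_cond (F := fun Y : {set E} => #|Y :&: X|) _ (swapM x y xX yX).
  apply: leq_trans.
  rewrite -Xr (cardsD1 x X) xX /=; apply: subset_leq_card.
  by rewrite subsetI subsetUr subsetDl.
have r0 : 0 < r by rewrite -Xr; apply/card_gt0P; exists x.
apply/andP; split; last first.
  apply/andP; split; last by rewrite rX rM prednK.
  apply/forall_inP => z; rewrite inE => zX; rewrite rX prednK //.
  have := leq_bigmax_cond (F := fun Y : {set E} => #|Y :&: (z |: X)|) _
            (swapM x z xX zX).
  apply: leq_trans.
  rewrite (setIidPl _) ?card_swap ?Xr //.
  by rewrite setUS // subsetDl.
apply/minsetP; split.
  by apply/negP => /exists_inP[Y YM] /(XsubE _ YM).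
move=> Y Ydep YX; apply/eqP; rewrite eqEsubset YX /=.
apply/subsetP => z zX; apply: contraNT Ydep => zY.
apply/exists_inP; exists (y |: (X :\ z)); first exact: swapM.
by apply: subset_trans (subsetUr _ _); rewrite subsetD1 YX.
Qed.

Lemma invariant_nonbases M (p : {perm E}) :
  p \in matroid_aut M -> invariant p (nonbases M).
Proof.
rewrite inE => /forallP pM; apply/forallP => X.
by rewrite !inE (eqP (pM X)) card_imset //; exact: perm_inj.
Qed.

Definition sparse_paving_of_rank r : {set matroid E} :=
  [set M : matroid E | sparse_paving M && (matroid_rank M == r)].

(** At most one stable set, the full layer, fails to come from a matroid. Since [r <= #|E|] this
    layer is nonempty, so the empty family is a different stable set, and discarding the layer loses
    at most half. *)
Lemma card_stable_sparse_paving r : r <= #|E| ->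
  #|stable E r| <= 2 * #|sparse_paving_of_rank r|.
Proof.
move=> rE; apply: (@leq_trans (2 * #|stable E r :\ layer E r|)).
  have st0 : set0 \in stable E r :\ layer E r.
    rewrite in_setD1; apply/andP; split; last first.
      by apply/stableP; split=> [X|X Y]; rewrite inE.
    rewrite eq_sym -card_gt0.
    by have -> : #|layer E r| = 'C(#|E|, r); [exact: card_draws|rewrite bin_gt0].
  have : 0 < #|stable E r :\ layer E r| by apply/card_gt0P; exists set0.
  rewrite (cardsD1 (layer E r) (stable E r)).
  move: #|_| (leq_b1 (layer E r \in stable E r)) => m; move: (nat_of_bool _) => c; lia.
rewrite leq_mul2l /=; apply: leq_trans (leq_imset_card (@nonbases) _).
apply/subset_leq_card/subsetP => S; rewrite in_setD1 => /andP[Sneq Sst].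
have [M [Msp Mr <-]] := stable_nonbases Sst Sneq.
by apply: imset_f; rewrite inE Msp Mr eqxx.
Qed.

Lemma card_symmetric_sparse_paving r :
  #|[set M in sparse_paving_of_rank r | matroid_aut M != 1%g]|
    <= #|symmetric_stable E r|.
Proof.
rewrite -(card_in_imset (f := @nonbases)); last first.
  move=> M N; rewrite !inE => /andP[/andP[_ /eqP rM] _] /andP[/andP[_ /eqP rN] _].
  by apply: nonbases_inj; rewrite rM.
apply/subset_leq_card/subsetP => _ /imsetP[M /setIdP[/setIdP[Msp /eqP Mr] Maut] ->].
apply/setIdP; split; first by rewrite -Mr nonbases_stable.
have /trivgPn[p pM p1] := Maut.
by apply/existsP; exists p; rewrite p1 invariant_nonbases.
Qed.

End SparsePaving.

(** * Summation over all ranks *)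

Lemma sum_card_of_rank n (P : pred (matroid 'I_n)) :
  \sum_(r < n.+1) #|[set M in sparse_paving_of_rank 'I_n r | P M]|
    = #|[set M in sparse_paving_matroids n | P M]|.
Proof.
have rk_lt (M : matroid 'I_n) : matroid_rank M < n.+1.
  have [B BM] := ex_basis M; rewrite (rank_basis BM) ltnS.
  by apply: leq_trans (max_card _) _; rewrite card_ord.
rewrite -[RHS]sum1_card (partition_big (fun M => Ordinal (rk_lt M)) xpredT) //=.
apply: eq_bigr => r _; rewrite -sum1_card; apply: eq_bigl => M.
by rewrite !inE -val_eqE /= andbAC.
Qed.

(** Rank 0 already contributes, through the empty stable family. *)
Lemma card_sparse_paving_gt0 n : 0 < #|sparse_paving_matroids n|.
Proof.
have := sum_card_of_rank (n := n) predT; rewrite big_ord_recl /=.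
have c0 : 0 < #|stable 'I_n 0|.
  by apply/card_gt0P; exists set0; apply/stableP; split=> [X|X Y]; rewrite inE.
have := card_stable_sparse_paving (leq0n #|'I_n|).
rewrite (_ : [set M in sparse_paving_matroids n | _] = sparse_paving_matroids n).
  rewrite (_ : [set M in sparse_paving_of_rank _ _ | _] = sparse_paving_of_rank 'I_n 0).
    move=> /(leq_trans c0); rewrite muln_gt0 /= => c1 <-.
    exact: leq_trans c1 (leq_addr _ _).
  by apply/setP => M; rewrite !inE andbT.
by apply/setP => M; rewrite !inE andbT.
Qed.

(** After multiplication by [n], [main1] bounds the permutation term of [badSt] and [main2] its
    small-layer term, each by [2 ^ K * St]. The constant 4 is these two contributions times the
    factor 2 of [StSP]. *)
Lemma symmetric_sparse_paving_rare : exists N : nat, forall n, N <= n ->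
  n * #|[set M in sparse_paving_matroids n | matroid_aut M != 1%g]|
    <= 4 * #|sparse_paving_matroids n|.
Proof.
(* In [main2] the exponent, at most [8 * n ^ 7], is multiplied by [n * n.+1] and must stay below
   [2 ^ n]; [n ^ 10] suffices once [8 * n.+1 <= n * n], which 16 ensures. *)
have [N0 hN0] := expn_le_exp2 10; exists (maxn N0 16) => n.
rewrite geq_max => /andP[/hN0 n10 n16].
have n0 : 0 < n by lia.
pose St := \sum_(r < n.+1) #|stable 'I_n r|.
set bad := #|[set M in _ | _]|.
have StSP : St <= 2 * #|sparse_paving_matroids n|.
  have -> : sparse_paving_matroids n = [set M in sparse_paving_matroids n | predT M].
    by apply/setP => M; rewrite !inE andbT.
  rewrite -sum_card_of_rank big_distrr /=; apply: leq_sum => r _.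
  rewrite (_ : [set M in sparse_paving_of_rank _ _ | _] = sparse_paving_of_rank 'I_n r).
    by apply: card_stable_sparse_paving; rewrite card_ord -ltnS.
  by apply/setP => M; rewrite !inE andbT.
pose K := n ^ 3.
have badSt : 2 ^ K * bad <=
    n`! * K.+1 * St + n.+1 * (2 ^ K * 2 ^ (6 * K * n ^ 4)).
  rewrite /bad -sum_card_of_rank -[n.+1 in X in _ + X]card_ord -sum_nat_const.
  rewrite !big_distrr -big_split /=; apply: leq_sum => r _.
  apply: leq_trans (leq_mul (leqnn _) (card_symmetric_sparse_paving _ _)) _.
  have := @card_symmetric_stable 'I_n r K; rewrite card_ord; apply => //.
  by rewrite expn_gt0 n0.
have [r [S [Sst nS]]] := large_stable n0.
have StS : 2 ^ #|S| <= St.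
  rewrite /St (bigD1 r) //=; apply: leq_trans (leq_addr _ _).
  exact: exp2_le_card_stable.
have main1 : n * (n`! * K.+1) <= 2 ^ K.
  have n2 : n <= 2 ^ n by rewrite ltnW // ltn_expl.
  have K2 : K.+1 <= 2 ^ (n * 3).
    by rewrite expnM ltn_exp2r // ltn_expl.
  apply: leq_trans (leq_mul n2 (leq_mul (fact_le_exp2 n) K2)) _.
  (* The exponents to compare are [n + (n * n + n * 3)] and [n ^ 3]. *)
  rewrite -!expnD leq_exp2l // /K !expnS expn0 muln1; nia.
have main2 : n * n.+1 * 2 ^ (6 * K * n ^ 4) <= 2 ^ #|S|.
  have n2 : n * n.+1 <= 2 ^ (n + n).
    rewrite expnD; apply: leq_mul; last exact: ltn_expl.
    by apply: ltnW; exact: ltn_expl.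
  apply: leq_trans (leq_mul n2 (leqnn _)) _; rewrite -expnD leq_exp2l //.
  rewrite -(@leq_pmul2r (n * n.+1)) ?muln_gt0 ?n0 //.
  apply: leq_trans nS; apply: leq_trans n10.
  rewrite /K -mulnA -expnD /=.
  have -> : n ^ 10 = n ^ 7 * (n * (n * n)).
    by rewrite (expnD n 7 3) (expnS n 2) (expnS n 1) expn1.
  have n7 : n <= n ^ 7 by rewrite -{1}(expn1 n) leq_exp2l //; lia.
  move: (n ^ 7) n7 => w n7.
  apply: (@leq_trans (8 * w * (n * n.+1))); first by rewrite leq_mul2r; lia.
  nia.
rewrite -(@leq_pmul2l (2 ^ K)) ?expn_gt0 //.
rewrite mulnCA; apply: leq_trans (leq_mul (leqnn n) badSt) _.
apply: (@leq_trans (2 ^ K * (2 * St))); last by rewrite leq_mul2l; lia.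
rewrite mulnDr mul2n -addnn mulnDr mulnA leq_add //.
  by rewrite leq_mul2r main1 orbT.
rewrite (_ : n * _ = 2 ^ K * (n * n.+1 * 2 ^ (6 * K * n ^ 4))).
  by rewrite leq_mul2l (leq_trans main2) // orbT.
by rewrite [n.+1 * _]mulnCA [n * _]mulnCA (mulnA n).
Qed.

(* Passage to the limit *)
From mathcomp Require Import all_classical all_reals all_analysis.
Import GRing.Theory Num.Theory numFieldNormedType.Exports.

Local Open Scope classical_set_scope.
Local Open Scope ring_scope.

Theorem theorem1p3 (R : realType) :
  (fun n : nat =>
     #|[pred M in sparse_paving_matroids n | matroid_aut M == 1%g]|%:R
       / #|sparse_paving_matroids n|%:R : R) @ \oo --> (1 : R).
Proof.
have [N rare] := symmetric_sparse_paving_rare.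
(* The rarity bound says that the symmetric proportion is at most [4 / n]. *)
apply: (@squeeze_cvgr _ _ _ _ (fun n => 1 - 4 * n%:R^-1) (fun=> 1)).
- exists N.+1 => // n /= nN.
  have n0 : (0 < n)%N by apply: leq_trans nN.
  set sp := #|sparse_paving_matroids n|; set good := #|_|.
  have sp0 : (0 < sp)%N := card_sparse_paving_gt0 n.
  have := rare n (ltnW nN); set bad := #|_| => badle.
  have spE : (good + bad)%N = sp.
    rewrite /sp -(cardsID [set M | matroid_aut M == 1%g] (sparse_paving_matroids n)).
    by congr (_ + _)%N; apply: eq_card => M; rewrite !inE // andbC.
  rewrite ler_pdivrMr ?ler_pdivlMr ?ltr0n // mul1r ler_nat.
  rewrite -spE leq_addr andbT mulrBl mul1r lerBlDr.
  rewrite natrD lerD2l mulrAC ler_pdivlMr ?ltr0n //.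
  by rewrite -natrD -!natrM ler_nat mulnC spE.
- rewrite -[X in _ --> X]subr0 -(mulr0 4); apply: cvgB; first exact: cvg_cst.
  apply: cvgM; first exact: cvg_cst.
  apply/gtr0_cvgV0; last exact: cvgr_idn.
  by near=> n; rewrite ltr0n; near: n; exact: nbhs_infty_gt.
- exact: cvg_cst.
Unshelve. all: by end_near. Qed.
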